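(* Suppose that $n \geq 3$ and $q$ are primes, let $\alpha$ be a primitive element of $\mathbb{F}_{q^n}$, and let $A_\alpha$ be the normalizer in $\mathrm{GL}(n,q)$ of the Singer subgroup $C_\alpha$. Then any two distinct nontrivial $q$-Steiner systems $\mathcal{S}_q[t,k,n]$ that both admit $A_\alpha$ as a group of automorphisms are nonisomorphic.
   Context: Identify $\mathbb{F}_q^n$ with $\mathbb{F}_{q^n}$ as an $\mathbb{F}_q$-vector space; the Singer subgroup $C_\alpha\le \mathrm{GL}(n,q)$ is the cyclic group generated by multiplication by the primitive element $\alpha$. A $q$-Steiner system $\mathcal{S}_q[t,k,n]$ is a set $\mathcal{S}$ of $k$-dimensional subspaces of $\mathbb{F}_q^n$ such that each $t$-dimensional subspace is contained in exactly one element of $\mathcal{S}$; it is nontrivial if $t<k<n$. $\mathrm{GL}(n,q)$ acts on sets of subspaces elementwise; $\mathcal{S}^g$ denotes the image of $\mathcal{S}$ under $g$. Two sets $\mathcal{S}_1,\mathcal{S}_2$ of subspaces are isomorphic if $\mathcal{S}_2=\mathcal{S}_1^g$ for some $g\in\mathrm{GL}(n,q)$. $g$ is an automorphism of $\mathcal{S}$ if $\mathcal{S}^g=\mathcal{S}$; a group $A$ is a group of automorphisms of $\mathcal{S}$ if every element of $A$ is an automorphism. *)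

(* Defs.v *)
From HB Require Import structures.
From mathcomp Require Import all_boot all_order all_algebra all_fingroup all_field.

Set Implicit Arguments.
Unset Strict Implicit.
Unset Printing Implicit Defensive.

Import GRing.Theory FalgLfun VectorInternalTheory.

Local Open Scope group_scope.

HB.instance Definition _ (F : finFieldType) (V : vectType F) :=
  [Countable of {vspace V} by <:].
HB.instance Definition _ (F : finFieldType) (V : vectType F) :=
  [Finite of {vspace V} by <:].

Section Singer.
Variables (F : finFieldType) (L : fieldExtType F).

(* The finite group of invertible F-linear endomorphisms of L.  In the algebra
   'End(L) the product f * g is "f, then g", so U |-> g @: U below is a right
   action. *)
Definition GL : finGroupType := {unit (finvect_type 'End(L))}.

Definition GL_lfun (g : GL) : 'End(L) := val g.

(* primitive element in the sense of finite fields: a generator of the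
   multiplicative group (not merely a generator of the field extension L / F) *)
Definition primitive_element (a : L) : Prop :=
  a != 0%R /\ forall x : L, x != 0%R -> exists i : nat, x = (a ^+ i)%R.

(* For a != 0 the generating set is a singleton. *)
Definition singer (a : L) : {group GL} :=
  <<[set g : GL | GL_lfun g == amulr a]>>%G.

Definition singer_normalizer (a : L) : {group GL} := 'N(singer a)%G.

Definition image_system (S : {set {vspace L}}) (g : GL) : {set {vspace L}} :=
  [set (GL_lfun g @: U)%VS | U in S].

Definition isomorphic_systems (S1 S2 : {set {vspace L}}) : Prop :=
  exists g : GL, S2 = image_system S1 g.

Definition automorphism (S : {set {vspace L}}) (g : GL) : Prop :=
  image_system S g = S.

Definition group_of_automorphisms (A : {group GL}) (S : {set {vspace L}}) :
    Prop :=
  forall g, g \in A -> automorphism S g.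

Definition q_steiner (t k : nat) (S : {set {vspace L}}) : Prop :=
  (forall U, U \in S -> \dim U = k) /\
  (forall T : {vspace L}, \dim T = t -> exists! U, U \in S /\ (T <= U)%VS).

End Singer.

(* Main.v *)
(* A prime r dividing q^n - 1 but no q^d - 1 with 0 < d < n exists because n is an
   odd prime.  An element of order r in GL(n,q) fixing a nonzero vector fixes q^d
   vectors with q^d = q^n = 1 mod r, hence all of them; so every r-subgroup of
   GL(n,q) acts semiregularly on nonzero vectors, and a Sylow r-subgroup R of the
   Singer group C is Sylow in every overgroup.  Since R generates F_{q^n} as an
   F_q-algebra, C(R) = C and so N(R) is contained in A = N(C).  If S2 = S1^g, then
   R and R^g are Sylow subgroups of Aut(S2), so R^g = R^h with h in Aut(S2), and
   g h^-1 lies in N(R), hence in Aut(S1); thus S1 = S1^(g h^-1) = S2^(h^-1) = S2. *)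
Require Import Defs.
From mathcomp Require Import all_boot all_order all_algebra all_fingroup all_field.
From mathcomp Require Import all_solvable zify.

Set Implicit Arguments.
Unset Strict Implicit.
Unset Printing Implicit Defensive.

Import GRing.Theory FalgLfun.

(** * Primitive prime divisors of [q ^ n - 1] for an odd prime [n] *)

Definition primitive_prime_divisor (q n r : nat) : Prop :=
  [/\ prime r, r %| q ^ n - 1 & forall d, 0 < d -> r %| q ^ d - 1 -> n <= d].

Lemma dvdn_expn_sub1 (q r d : nat) :
  0 < q -> (r %| q ^ d - 1) = (q ^ d == 1 %[mod r]).
Proof. by move=> q0; rewrite eqn_mod_dvd // expn_gt0 q0. Qed.

(** The order of [q] modulo [r] divides both [n] and [d]. Concretely, Bezout gives
    [u * d = v * n + 1], and raising [q] to both sides leaves [1 = q] modulo [r]. *)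
Lemma coprime_dvdn_expn_sub1 (q r n d : nat) : 0 < q -> 0 < d -> coprime d n ->
  r %| q ^ n - 1 -> r %| q ^ d - 1 -> r %| q - 1.
Proof.
move=> q0 d0 /eqP co; rewrite -{3}[q]expn1 !dvdn_expn_sub1 // => /eqP hn /eqP hd.
case: (egcdnP n d0) => u v Euv _; rewrite co in Euv.
have: q ^ (u * d) == 1 %[mod r] by rewrite mulnC expnM -modnXm hd modnXm exp1n.
by rewrite Euv expnD (mulnC v) expnM -modnMml -modnXm hn modnXm exp1n modnMml mul1n expn1.
Qed.

Lemma sum_expn_mod1 (q r n : nat) : q = 1 %[mod r] ->
  \sum_(i < n) q ^ i = n %[mod r].
Proof.
move=> hq; elim: n => [|n IH]; first by rewrite big_ord0.
by rewrite big_ord_recr /= -modnDm IH -modnXm hq modnXm exp1n modnDm addn1.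
Qed.

(** Modulo [n ^ 2] the binomial expansion stops after the linear term, so the sum is
    [n + n * m * 'C(n, 2)]; for odd [n], [n] divides ['C(n, 2)]. *)
Lemma sum_expn_mod_sqr (n m : nat) : odd n ->
  \sum_(i < n) (1 + n * m) ^ i = n %[mod n ^ 2].
Proof.
move=> on.
have pw i : (1 + n * m) ^ i = 1 + n * (i * m) %[mod n ^ 2].
  elim: i => [|i IH]; first by rewrite mul0n muln0.
  rewrite expnS -modnMmr IH modnMmr.
  have ->: (1 + n * m) * (1 + n * (i * m))
           = (m * (i * m)) * n ^ 2 + (1 + n * (i.+1 * m)).
    rewrite expnS expn1; nia.
  by rewrite modnMDl.
have sm k : \sum_(i < k) (1 + n * m) ^ i = k + n * m * 'C(k, 2) %[mod n ^ 2].
  elim: k => [|k IH]; first by rewrite big_ord0 muln0.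
  rewrite big_ord_recr /= -modnDm IH pw modnDm binS bin1; congr (_ %% _); nia.
rewrite sm bin2odd //.
have ->: n + n * m * (n * n.-1./2) = (m * n.-1./2) * n ^ 2 + n.
  rewrite expnS expn1; nia.
by rewrite modnMDl.
Qed.

(* The special case of Zsigmondy's theorem with an odd prime exponent: a prime
   factor of 1 + q + ... + q^(n-1) that is not primitive divides q - 1, hence is
   n, and n^2 does not divide this sum. *)
Lemma primitive_prime_divisor_exists (q n : nat) : 1 < q -> prime n -> odd n ->
  exists r, primitive_prime_divisor q n r.
Proof.
move=> q1 pn on; set P := \sum_(i < n) q ^ i.
have q0 : 0 < q by lia.
have n2 : 2 < n by case: n pn on {P} => [|[|[|]]].
have PE : q ^ n - 1 = (q - 1) * P by rewrite !subn1 predn_exp.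
(* This bound excludes [P = 1] and [P = n] once [P] is known to be a power of [n]. The term [q]
   exceeds [1] by [q - 1], and all others are at least [1]. *)
have Pn : n < P.
  have H : n + (q - 1) <= P.
    rewrite /P; case: n n2 {pn on P PE} => [|[|n]] // _.
    rewrite !big_ord_recl /= expn0 expn1.
    have : \sum_(i < n) 1 <= \sum_(i < n) q ^ bump 0 (bump 0 i).
      by apply: leq_sum => i _; rewrite expn_gt0 q0.
    rewrite sum1_card card_ord; move: (\sum_(i < n) _) => s; lia.
  lia.
have PD p : prime p -> p %| P -> p %| q - 1 -> p = n.
  move=> pp pP; rewrite -{1}[q]expn1 dvdn_expn_sub1 // expn1 => /eqP pq.
  move: pP; rewrite /dvdn /P (sum_expn_mod1 n pq) => /(_ =P 0) pn0.
  have: p %| n by rewrite /dvdn pn0.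
  by rewrite dvdn_prime2 // => /eqP.
have [/allP all_n | ] := boolP (all (dvdn^~ (q - 1)) (primes P)).
  have pP : n.-nat P.
    apply/pnatP; first by lia.
    move=> p pp pP; rewrite inE; apply/eqP; apply: PD => //.
    by apply: all_n; rewrite mem_primes pp pP; lia.
  case/p_natP: pP => e Pe.
  have e1 : 1 < e.
    rewrite ltnNge; apply/negP => e1; move: Pn; rewrite Pe.
    by case: e e1 {Pe} => [|[|]] // _; rewrite ?expn0 ?expn1; lia.
  have n2P : n ^ 2 %| P by rewrite Pe dvdn_exp2l.
  (* Then [q = 1 + n * m], so [P] is [n] modulo [n ^ 2], which contradicts [n2P]. *)
  have: n %| q - 1.
    apply: all_n; rewrite mem_primes pn /=; apply/andP; split; first by lia.
    by apply: (dvdn_trans _ n2P); rewrite expnS dvdn_mulr.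
  case/dvdnP=> m qm; move: n2P; rewrite /P.
  have ->: q = 1 + n * m by lia.
  rewrite /dvdn sum_expn_mod_sqr // modn_small; first by lia.
  by rewrite expnS expn1; nia.
case/allPn=> r; rewrite mem_primes => /and3P[pr _ rP] rq.
have rn : r %| q ^ n - 1 by rewrite PE dvdn_mull.
exists r; split=> // d d0 rd; rewrite leqNgt; apply/negP => dn.
case/negP: rq; apply: coprime_dvdn_expn_sub1 rn rd => //.
by rewrite coprime_sym prime_coprime // gtnNdvd.
Qed.

(** * The action of [GL L] on vectors and on systems of subspaces *)

Section SingerSylow.
Variables (F : finFieldType) (L : fieldExtType F).
Local Open Scope group_scope.

Lemma GL_lfunM (g h : GL L) : GL_lfun (g * h) = (GL_lfun g * GL_lfun h)%R.
Proof. by []. Qed.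

Lemma GL_lfun1 : GL_lfun (1 : GL L) = 1%R.
Proof. by []. Qed.

Lemma GL_lfun_inj : injective (@GL_lfun F L).
Proof. exact: val_inj. Qed.

(** The type [finvect_type L] is [L] with its finite structure, which orbit and fixed-point counting
    require. *)
Definition GL_ev (v : finvect_type L) (g : GL L) : finvect_type L := GL_lfun g v.

Lemma GL_ev1 : GL_ev^~ 1 =1 id.
Proof. by move=> v; rewrite /GL_ev GL_lfun1 lfunE. Qed.

Lemma GL_evM v : act_morph GL_ev v.
Proof. by move=> g h; rewrite /GL_ev GL_lfunM lfun_mulE. Qed.

Definition GL_action := TotalAction GL_ev1 GL_evM.

Lemma GL_ev_eq0 v g : (GL_ev v g == 0%R) = (v == 0%R).
Proof.
apply/eqP/eqP=> [|->]; last by rewrite /GL_ev linear0.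
move=> v0; rewrite -[v]GL_ev1 -(mulgV g) GL_evM v0 /GL_ev; exact: linear0.
Qed.

Lemma image_systemM (S : {set {vspace L}}) (g h : GL L) :
  image_system S (g * h) = image_system (image_system S g) h.
Proof.
rewrite /image_system -imset_comp; apply: eq_imset => U /=.
by rewrite GL_lfunM -lfun_compE limg_comp.
Qed.

Lemma image_system1 (S : {set {vspace L}}) : image_system S 1 = S.
Proof.
rewrite /image_system -[RHS]imset_id; apply: eq_imset => U.
by rewrite GL_lfun1 lim1g.
Qed.

Definition automorphisms (S : {set {vspace L}}) : {set GL L} :=
  [set g | image_system S g == S].

Lemma automorphisms_group_set S : group_set (automorphisms S).
Proof.
apply/group_setP; split=> [|g h]; rewrite !inE ?image_system1 // image_systemM.
by move=> /eqP-> .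
Qed.

Canonical automorphisms_group S := Group (automorphisms_group_set S).

Lemma amulr_unit (x : L) : x != 0%R ->
  (amulr x : finvect_type 'End(L)) \is a GRing.unit.
Proof.
move=> x0; apply/GRing.unitrP; exists (amulr x^-1)%R.
by rewrite -!rmorphM mulVf // divff // rmorph1.
Qed.

(** Powers of [a] exhaust the nonzero elements, so the Singer group consists of all invertible
    multiplications; [x = 0] would make [g] send [1] to [0]. *)
Lemma mem_singer (a : L) (g : GL L) : primitive_element a ->
  reflect (exists x, GL_lfun g = amulr x) (g \in singer a).
Proof.
case=> a0 pa; have ua := amulr_unit a0; pose c : GL L := FinRing.Unit ua.
have cE i : GL_lfun (c ^+ i) = amulr (a ^+ i)%R.
  elim: i => [|i IH]; first by rewrite expg0 expr0 rmorph1.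
  by rewrite expgS GL_lfunM IH exprS rmorphM.
have -> : (singer a : {set GL L}) = <[c]>.
  congr <<_>>; apply/setP=> h; rewrite !inE; apply/eqP/eqP => [hE|->] //.
  exact: GL_lfun_inj.
apply: (iffP (cycleP c g)) => [[i ->]|[x gx]]; first by exists (a ^+ i)%R.
have x0 : x != 0%R.
  apply/eqP=> x0; have := GL_ev_eq0 1%R g; rewrite /GL_ev gx x0 lfunE /= mulr0.
  by rewrite eqxx oner_eq0.
by have [i xE] := pa x x0; exists i; apply: GL_lfun_inj; rewrite cE gx xE.
Qed.


Lemma card_finvect : #|finvect_type L| = (#|F| ^ \dim {:L})%N.
Proof.
rewrite -(card_vspace {:finvect_type L}%VS).
by apply: eq_card => v; rewrite memvf.
Qed.

Lemma card_GL_fix (g : GL L) :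
  #|'Fix_GL_action[g]| = (#|F| ^ \dim (lker (GL_lfun g - 1)%R))%N.
Proof.
rewrite -(@card_vspace F (finvect_type L)); apply: eq_card => v.
rewrite memv_ker add_lfunE opp_lfunE lfunE /= subr_eq0.
exact: (sameP afix1P eqP).
Qed.

(** * Semiregularity of [r]-subgroups on nonzero vectors *)

Variable r : nat.
Hypothesis ppd : primitive_prime_divisor #|F| (\dim {:L}) r.

Lemma semiregular_GL_pgroup (P : {group GL L}) (v : finvect_type L) :
  r.-group P -> v != 0%R -> 'C_P[v | GL_action] = 1.
Proof.
move=> rP v0; apply/eqP; apply: contraT => ntC.
have rC : r.-group 'C_P[v | GL_action] := pgroupS (subsetIl _ _) rP.
have [pr rn rmin] := ppd; have [_ rdvd _] := pgroup_pdiv rC ntC.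
have [g] := Cauchy pr rdvd.
rewrite inE => /andP[gP /astab1P gv] og.
have q0 : 0 < #|F| by apply/card_gt0P; exists 0%R.
have rg : r.-group <[g]> by rewrite /pgroup -orderE og pnat_id.
have := @pgroup_fix_mod _ _ _ GL_action r _ setT rg.
rewrite setTI afix_cycle ?inE // card_GL_fix cardsT card_finvect.
set n := \dim {:_}; set d := \dim _ => H.
have {}H : (#|F| ^ n = #|F| ^ d %[mod r])%N by apply: H; apply/actsP => h _ w; rewrite !in_setT.
(* The vector [v] is itself fixed by [g]; primitivity of [r] speaks of positive exponents. *)
have d0 : 0 < d.
  rewrite lt0n dimv_eq0; apply/eqP => k0; case/eqP: v0; apply/eqP.
  rewrite -(@memv0 F L) -k0 memv_ker add_lfunE opp_lfunE lfunE /=.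
  by rewrite subr_eq0; apply/eqP.
have nd : n <= d.
  by apply: rmin => //; move: rn; rewrite !dvdn_expn_sub1 // -H.
have kf : lker (GL_lfun g - 1)%R = fullv.
  by apply/eqP; rewrite eqEdim subvf.
have g1 : g = 1.
  apply: GL_lfun_inj; apply/lfunP => u.
  have: u \in lker (GL_lfun g - 1)%R by rewrite kf memvf.
  by rewrite memv_ker add_lfunE opp_lfunE subr_eq0 GL_lfun1 => /eqP.
by move: og pr; rewrite g1 order1 => <-.
Qed.

(** Stabilizers are trivial, so the nonzero vectors split into orbits of size [#|P|]. *)
Lemma card_GL_pgroup_dvdn (P : {group GL L}) :
  r.-group P -> #|P| %| (#|F| ^ \dim {:L} - 1)%N.
Proof.
move=> rP; pose S : {set finvect_type L} := [set~ 0%R].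
have -> : (#|F| ^ \dim {:L} - 1)%N = #|S|.
  by rewrite cardsC1 card_finvect subn1.
have aPS : [acts P, on S | GL_action].
  by apply/actsP => g _ v; rewrite !inE /= GL_ev_eq0.
rewrite (card_uniform_partition (n := #|P|) _ (orbit_partition aPS)) ?dvdn_mull //.
move=> _ /imsetP[v Sv ->]; rewrite card_orbit semiregular_GL_pgroup ?indexg1 //.
by move: Sv; rewrite !inE.
Qed.

(** * Sylow [r]-subgroups of the Singer group, their centralizers and normalizers *)

Variable a : L.
Hypothesis pa : primitive_element a.

(** Evaluation at [1] is a bijection from the Singer group onto the nonzero elements of [L]. *)
Lemma card_singer : #|singer a| = (#|F| ^ \dim {:L} - 1)%N.
Proof.
rewrite subn1 -card_finvect -(cardsC1 (0%R : finvect_type L)).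
rewrite -(card_in_imset (f := GL_ev 1%R) (D := singer a)); last first.
  move=> g h /(mem_singer _ pa)[x gx] /(mem_singer _ pa)[y hy].
  rewrite /GL_ev gx hy !lfunE /= !mul1r => xy; apply: GL_lfun_inj.
  by rewrite gx hy xy.
apply: eq_card => x; rewrite !inE; apply/imsetP/idP => [[g _ ->]|x0].
  by rewrite GL_ev_eq0 oner_eq0.
exists (FinRing.Unit (amulr_unit x0) : GL L); first by apply/mem_singer => //; exists x.
by rewrite /GL_ev lfunE /= mul1r.
Qed.

(** A Sylow [r]-subgroup of [H] above [R] has order dividing the [r]-part of [#|singer a|], which is
    [#|R|]. *)
Lemma Sylow_singer_overgroup (R H : {group GL L}) :
  r.-Sylow(singer a) R -> R \subset H -> r.-Sylow(H) R.
Proof.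
move=> sylR RH; have [P sylP RP] := Sylow_superset RH (pHall_pgroup sylR).
suff -> : R = P by [].
apply/val_inj/eqP; rewrite eqEcard RP (card_Hall sylR) card_singer.
have rP := pHall_pgroup sylP.
rewrite dvdn_leq // -(part_pnat_id rP) partn_dvd ?card_GL_pgroup_dvdn //.
by rewrite -card_singer cardG_gt0.
Qed.

(** If [x] generates a subfield of degree [d], then [x ^ (q ^ d - 1) = 1] with [q = #|F|]. As [x]
    has order [r], [r] divides [q ^ d - 1], and primitivity forces [d] to be the full degree. *)
Lemma adjoin_order_r (x : L) : x != 1%R -> (x ^+ r = 1)%R -> <<1; x>>%VS = fullv.
Proof.
move=> x1 xr; have [pr rn rmin] := ppd.
apply/eqP; rewrite eqEdim subvf; apply: rmin; first by rewrite adim_gt0.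
have x0 : x != 0%R.
  apply/eqP => x0; move: xr; rewrite x0 expr0n eqn0Ngt prime_gt0 //= => /eqP.
  by rewrite eq_sym oner_eq0.
have : x \in <<1; x>>%AS by exact: memv_adjoin.
rewrite Fermat's_little_theorem /=; set m := (#|F| ^ _)%N => /eqP xm.
have xm1 : (x ^+ (m - 1)%N = 1)%R.
  apply: (mulfI x0); rewrite -exprS subn1 prednK ?xm ?mulr1 //.
  by rewrite expn_gt0; apply/orP; left; apply/card_gt0P; exists 0%R.
apply: contraT; rewrite -prime_coprime // => co; case/eqP: x1.
case: (egcdnP (m - 1)%N (prime_gt0 pr)) => u v; rewrite (eqP co) => uvE _.
have : (x ^+ (u * r) = x ^+ (v * (m - 1) + 1))%R by rewrite uvE.
by rewrite exprD expr1 mulnC exprM xr mulnC exprM xm1 !expr1n mul1r.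
Qed.

(** Commuting with multiplication by a generator [x] makes [g] linear over [L], hence multiplication
    by its value at [1]. *)
Lemma cent_amulr_adjoin (x : L) (g h : GL L) : <<1; x>>%VS = fullv ->
  GL_lfun h = amulr x -> commute g h -> exists y, GL_lfun g = amulr y.
Proof.
move=> xL hx cgh; exists (GL_lfun g 1%R); apply/lfunP => u; rewrite lfunE /=.
have gx v : GL_lfun g (v * x)%R = (GL_lfun g v * x)%R.
  have /(congr1 (fun f : GL L => GL_lfun f v)) := cgh.
  by rewrite !GL_lfunM !lfun_mulE hx !lfunE /=.
have gxi i : GL_lfun g (x ^+ i)%R = (x ^+ i * GL_lfun g 1)%R.
  elim: i => [|i IH]; first by rewrite expr0 mul1r.
  by rewrite exprSr gx IH mulrAC.
have /Fadjoin_polyP[p p1 ->] : u \in <<1; x>>%VS by rewrite xL memvf.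
rewrite horner_coef linear_sum mulr_suml; apply: eq_bigr => i _ /=.
have /vlineP[c ->] := polyOverP p1 i.
by rewrite -!scalerAl mul1r linearZ /= gxi.
Qed.

Lemma singer_abelian : abelian (singer a).
Proof.
apply/centsP => g /(mem_singer _ pa)[x gx] h /(mem_singer _ pa)[y hy].
by apply: GL_lfun_inj; rewrite !GL_lfunM gx hy -!rmorphM mulrC.
Qed.

(** One element of order [r] in [R] is multiplication by a generator of [L], so its centralizer
    already lies in the Singer group; the converse inclusion is commutativity. *)
Lemma cent_Sylow_singer (R : {group GL L}) :
  r.-Sylow(singer a) R -> 'C(R) = singer a.
Proof.
move=> sylR; have RC := pHall_sub sylR; have [pr rn _] := ppd.
apply/eqP; rewrite eqEsubset andbC centsC (subset_trans RC singer_abelian) /=.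
have rR : r %| #|R|.
  rewrite (card_Hall sylR) card_singer -{1}(part_pnat_id (pnat_id pr)).
  by rewrite partn_dvd // -card_singer cardG_gt0.
have [h hR oh] := Cauchy pr rR.
have /(mem_singer _ pa)[x hx] := subsetP RC _ hR.
have xL : <<1; x>>%VS = fullv.
  apply: adjoin_order_r.
    apply/eqP=> x1; move: oh pr; suff -> : h = 1 by rewrite order1 => <-.
    by apply: GL_lfun_inj; rewrite hx x1 rmorph1.
  apply: amulr_inj; rewrite rmorph1 -GL_lfun1 -(expg_order h) oh.
  elim: r => [|i IH]; first by rewrite expg0 expr0 rmorph1.
  by rewrite expgS GL_lfunM -IH exprS rmorphM hx.
apply/subsetP => g /centP cg; apply/(mem_singer _ pa).
exact: cent_amulr_adjoin xL hx (cg h hR).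
Qed.

Lemma norm_Sylow_singer (R : {group GL L}) :
  r.-Sylow(singer a) R -> 'N(R) \subset singer_normalizer a.
Proof. by move=> sylR; rewrite /= -(cent_Sylow_singer sylR) norms_cent. Qed.

Lemma isomorphic_systems_eq (S1 S2 : {set {vspace L}}) :
  group_of_automorphisms (singer_normalizer a) S1 ->
  group_of_automorphisms (singer_normalizer a) S2 ->
  isomorphic_systems S1 S2 -> S1 = S2.
Proof.
move=> A1 A2 [g S2E].
have [R sylR] := Sylow_exists r (singer a).
have RA : R \subset singer_normalizer a := subset_trans (pHall_sub sylR) (normG _).
have RH : R \subset automorphisms_group S2.
  by apply/subsetP => x /(subsetP RA)/A2 xS; rewrite inE; apply/eqP.
have RgH : R :^ g \subset automorphisms_group S2.
  apply/subsetP => _ /imsetP[x /(subsetP RA)/A1 xS ->]; rewrite inE S2E.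
  by rewrite -image_systemM conjgE mulKVg image_systemM xS.
have sylRH := Sylow_singer_overgroup sylR RH.
have sylRg : r.-Sylow(automorphisms_group S2) (R :^ g).
  by rewrite pHallE RgH cardJg (card_Hall sylRH) /=.
have [h hH RgE] := Sylow_trans sylRH sylRg.
have /A1 ghS : g * h^-1 \in singer_normalizer a.
  apply: (subsetP (norm_Sylow_singer sylR)); rewrite inE conjsgM.
  by have /= -> := RgE; rewrite conjsgK.
have : h^-1 \in automorphisms_group S2 by rewrite groupV.
by rewrite inE S2E -image_systemM ghS => /eqP.
Qed.

End SingerSylow.

Theorem theorem5 (n q : nat) (hn : prime n) (hn3 : (3 <= n)%N) (hq : prime q)
    (L : fieldExtType 'F_q) (hL : \dim {: L} = n)
    (alpha : L) (halpha : primitive_element alpha)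
    (t k : nat) (htk : (t < k)%N) (hkn : (k < n)%N)
    (S1 S2 : {set {vspace L}})
    (hS1 : q_steiner t k S1) (hS2 : q_steiner t k S2)
    (hA1 : group_of_automorphisms (singer_normalizer alpha) S1)
    (hA2 : group_of_automorphisms (singer_normalizer alpha) S2)
    (hneq : S1 <> S2) :
  ~ isomorphic_systems S1 S2.
Proof.
(* Oddness matters: [3 ^ 2 - 1 = 8] has no primitive prime divisor. *)
have on : odd n by case: (even_prime hn) hn3 => [->|].
have [r ppd] := primitive_prime_divisor_exists (prime_gt1 hq) hn on.
move=> iso; apply: hneq; apply: (@isomorphic_systems_eq _ _ r _ alpha) => //.
by rewrite hL card_Fp.
Qed.
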